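(* Let $G$ be a virtually polycyclic group, let $\varphi\in\operatorname{End}(G)$ and let $N$ be a finite index normal $\mathcal{NR}$-subgroup of $G$ with $\varphi(N)\le N$. Then the value $$\tilde R(\varphi,N):=\sum_{[t]_G\in\operatorname{Fix}(P_\varphi)}\frac{1}{[C_t:D_t]}\sum_{cD_t\in C_t/D_t}\tau\big((\iota_c\varphi_t)|_{D_t}\big)$$ is independent of all choices made and hence well-defined. More precisely: (1) for fixed $t$ and $g_t$, the value $\tau((\iota_c\varphi_t)|_{D_t})$ depends only on the coset $cD_t$ and not on the choice of representative $c$; (2) for every $[t]_G\in\operatorname{Fix}(P_\varphi)$, its summand $\frac{1}{[C_t:D_t]}\sum_{cD_t\in C_t/D_t}\tau((\iota_c\varphi_t)|_{D_t})$ does not depend on the choice of $g_t$; (3) for every $[t]_G\in\operatorname{Fix}(P_\varphi)$, its summand does not depend on the choice of the representative $t$.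
   Context: $\iota_g$ denotes $x\mapsto gxg^{-1}$. For $H\le G$, $\sqrt[G]{H}:=\{g\in G\mid\exists k\in\mathbb{N}: g^k\in H\}$. $\mathcal{NR}$-groups: a polycyclic group $G$ is strongly torsion-free if there is a short exact sequence $1\to K\to G\to\mathbb{Z}^n\to1$ with $K$ finitely generated torsion-free nilpotent. An $\mathcal{NR}$-group is a strongly torsion-free polycyclic group $G$ such that, for $H:=\sqrt[G]{[G,G]}$ and a central series $H=H_1\ge\cdots\ge H_{c+1}=1$ of $H$ with all $H_i$ normal in $G$ and all $H_i/H_{i+1}$ free abelian, for every $g\in G$ and every $i$ the automorphism of $H_i/H_{i+1}$ induced by $\iota_g$ has no root of unity other than $1$ as an eigenvalue (this is independent of the chosen series). Subgroups of $\mathcal{NR}$-groups are $\mathcal{NR}$-groups. Invariant $\tau$: for an $\mathcal{NR}$-group $G$ put $H:=\sqrt[G]{[G,G]}$, $\mathcal F_0(G):=G$, $\mathcal F_i(G):=\sqrt[H]{\gamma_i(H)}$ for $1\le i\le c+1$ (with $\gamma_i$ the lower central series, $\mathcal F_{c+1}(G)=1$). These terms are fully invariant and $\mathcal F_i(G)/\mathcal F_{i+1}(G)\cong\mathbb{Z}^{n_i}$ for $0\le i\le c$. For $\varphi\in\operatorname{End}(G)$ inducing $\varphi_i\in\mathbb{Z}^{n_i\times n_i}$ on these factors, $\tau(\varphi):=\prod_{i=0}^c|\det(I_{n_i}-\varphi_i)|$ (the determinant of a $0\times 0$ matrix is $1$). Notation in $\tilde R$: $P_\varphi$ is the map $[t]_G\mapsto[\varphi(t)]_G$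 on the (finite) set of $G$-conjugacy classes of torsion elements of $G$. For each $[t]_G\in\operatorname{Fix}(P_\varphi)$ choose a representative $t$ and $g_t\in G$ with $t=g_t\varphi(t)g_t^{-1}$; then $C_t:=C_G(t)$, $D_t:=C_N(t)$, $\varphi_t:=\iota_{g_t}\varphi$. $C_t$ and $D_t$ are $\varphi_t$-invariant and $D_t$ is a normal finite index $\mathcal{NR}$-subgroup of $C_t$. *)

(* Defs.v *)
From HB Require Import structures.
From mathcomp Require Import all_boot all_order all_algebra all_field.
From mathcomp Require Import finmap.
From mathcomp Require Import boolp classical_sets functions cardinality fsbigop.

Set Implicit Arguments.
Unset Strict Implicit.
Unset Printing Implicit Defensive.

Import GRing.Theory.

Local Open Scope classical_set_scope.
Local Open Scope group_scope.

(* Groups are possibly infinite.  All groups that occur are subgroups of one  *)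
(* ambient group G and are represented by their carriers, of type set G.      *)

Section Subgroups.
Variable G : groupType.
Implicit Types (A B K S : set G) (g x y t : G).

Definition subgroup A : Prop := A 1 /\ (forall x y, A x -> A y -> A (x / y)).

Definition generated S : set G :=
  \bigcap_(K in [set K | subgroup K /\ S `<=` K]) K.

(* iota_g; beware that mathcomp's x ^ g is g^-1 * x * g *)
Definition inner g x : G := g * x / g.

Definition normal_in A B : Prop :=
  [/\ subgroup B, B `<=` A & forall g x, A g -> B x -> B (inner g x)].

Definition lcoset B x : set G := [set x * b | b in B].

Definition lcosets A B : set (set G) := [set lcoset B x | x in A].

Definition finite_index A B : Prop :=
  [/\ subgroup B, B `<=` A & finite_set (lcosets A B)].

(* [A : B], meaningful when finite *)
Definition group_index A B : nat := #|` fset_set (lcosets A B)|.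

Definition commutator_subgroup A B : set G :=
  generated [set [~ a, b] | a in A & b in B].

(* gamma_i(A) for i >= 1, with gamma_1(A) = A (gamma_0(A) = A is a dummy) *)
Definition lower_central A (i : nat) : set G :=
  iter i.-1 (fun B => commutator_subgroup B A) A.

Definition isolator A B : set G :=
  [set g | A g /\ exists2 k : nat, (0 < k)%N & B (g ^+ k)].

Definition nilpotent_group A : Prop :=
  exists c : nat, lower_central A c.+1 = [set 1].

Definition nilpotency_class A : nat :=
  xget 0%N [set c | lower_central A c.+1 = [set 1] /\
    forall m, lower_central A m.+1 = [set 1] -> (c <= m)%N].

Definition torsion_free A : Prop :=
  forall x (k : nat), A x -> (0 < k)%N -> x ^+ k = 1 -> x = 1.

Definition finitely_generated A : Prop :=
  exists s : seq G, A = generated [set` s].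

(* A / B is cyclic, for B normal in A *)
Definition cyclic_factor A B : Prop :=
  exists2 x, A x & forall y, A y ->
    exists k : nat, lcoset B y = lcoset B (x ^+ k) \/
                    lcoset B y = lcoset B (x ^- k).

Definition polycyclic A : Prop :=
  exists (n : nat) (K : nat -> set G),
    [/\ K 0%N = A, K n = [set 1], subgroup A &
        forall i, (i < n)%N ->
          normal_in (K i) (K i.+1) /\ cyclic_factor (K i) (K i.+1)].

Definition virtually_polycyclic A : Prop :=
  exists2 K, finite_index A K & polycyclic K.

End Subgroups.

Section FreeAbelianFactors.
Variable G : groupType.
Implicit Types (A B : set G) (psi : G -> G).

(* f induces an isomorphism from A / B onto Z^n *)
Definition factor_coords A B (n : nat) (f : G -> 'rV[int]_n) : Prop :=
  [/\ forall x y, A x -> A y -> f (x * y) = (f x + f y)%R,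
      forall v, exists2 x, A x & f x = v &
      forall x, A x -> f x = 0%R <-> B x].

(* M is the matrix, acting on row vectors, of the endomorphism of A / B       *)
(* induced by psi, in the coordinates f                                       *)
Definition induced_matrix A psi (n : nat) (f : G -> 'rV[int]_n)
    (M : 'M[int]_n) : Prop :=
  forall x, A x -> f (psi x) = (f x *m M)%R.

(* Finite rank is automatic inside a polycyclic group. *)
Definition free_abelian_factor A B : Prop :=
  exists (n : nat) (f : G -> 'rV[int]_n), factor_coords A B f.

(* the absolute value of det (I - psi') for psi' induced by psi on A / B;     *)
(* it does not depend on the coordinates                                      *)
Definition factor_absdet A B psi : nat :=
  xget 0%N [set d | exists (n : nat) (f : G -> 'rV[int]_n) (M : 'M[int]_n),
    [/\ factor_coords A B f, induced_matrix A psi f M &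
        d = `|(\det (1%:M - M))%R|%N]].

End FreeAbelianFactors.

Section NRGroups.
Variable G : groupType.
Implicit Types (A B : set G) (psi : G -> G).

Definition strongly_torsion_free A : Prop :=
  exists K : set G,
    [/\ normal_in A K, finitely_generated K, torsion_free K, nilpotent_group K &
        free_abelian_factor A K].

Definition isolated_derived A : set G := isolator A (commutator_subgroup A A).

(* No eigenvalue of the automorphism of A / B induced by psi is a root of     *)
(* unity other than 1.                                                        *)
Definition net_on_factor A B psi : Prop :=
  forall (n : nat) (f : G -> 'rV[int]_n) (M : 'M[int]_n),
    factor_coords A B f -> induced_matrix A psi f M ->
    forall (z : algC) (k : nat), (0 < k)%N -> (z ^+ k)%R = 1%R ->
      eigenvalue (map_mx intr M) z -> z = 1%R.

Definition NR_group A : Prop :=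
  [/\ polycyclic A, strongly_torsion_free A &
      exists (c : nat) (Hs : nat -> set G),
        [/\ Hs 1%N = isolated_derived A, Hs c.+1 = [set 1],
            forall i, (1 <= i <= c.+1)%N -> normal_in A (Hs i) &
            forall i, (1 <= i <= c)%N ->
              [/\ Hs i.+1 `<=` Hs i,
                  commutator_subgroup (Hs i) (isolated_derived A)
                    `<=` Hs i.+1,
                  free_abelian_factor (Hs i) (Hs i.+1) &
                  forall g, A g ->
                    net_on_factor (Hs i) (Hs i.+1) (inner g)]]].

Definition tau_series A (i : nat) : set G :=
  if i is 0 then A
  else isolator (isolated_derived A) (lower_central (isolated_derived A) i).

(* tau (psi restricted to A) *)
Definition tau A psi : nat :=
  (\prod_(0 <= i < (nilpotency_class (isolated_derived A)).+1)
     factor_absdet (tau_series A i) (tau_series A i.+1) psi)%N.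

End NRGroups.

Section AveragedTau.
Variable G : groupType.
Implicit Types (phi : G -> G) (N A B K : set G) (g t : G).

Definition torsion : set G :=
  [set t | exists2 k : nat, (0 < k)%N & t ^+ k = 1].

Definition conj_class t : set G := [set inner g t | g in [set: G]].

Definition torsion_classes : set (set G) := [set conj_class t | t in torsion].

(* maps [t] to [phi t] *)
Definition class_map phi K : set G := \bigcup_(t in K) conj_class (phi t).

Definition fixed_classes phi : set (set G) :=
  [set K | torsion_classes K /\ class_map phi K = K].

Definition centraliser t : set G := [set x | commute x t].

Definition centraliser_in N t : set G := N `&` centraliser t.

Definition coset_reps A B (r : set G -> G) : Prop :=
  forall X, lcosets A B X -> X (r X).

(* The summand of [t], computed with the element g = g_t and with the         *)
(* representative r X of each coset X in C_t / D_t                            *)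
Definition Rtilde_summand phi N t g (r : set G -> G) : rat :=
  ((group_index (centraliser t) (centraliser_in N t))%:R^-1 *
   \sum_(X \in lcosets (centraliser t) (centraliser_in N t))
      ((tau (centraliser_in N t) (inner (r X) \o (inner g \o phi)))%:R : rat))%R.

(* t K represents K, g K is the element g_t for t = t K, and r K chooses the  *)
(* coset representatives                                                      *)
Definition Rtilde_choices phi N (t g : set G -> G)
    (r : set G -> set G -> G) : Prop :=
  forall K, fixed_classes phi K ->
    [/\ K (t K), t K = inner (g K) (phi (t K)) &
        coset_reps (centraliser (t K)) (centraliser_in N (t K)) (r K)].

Definition Rtilde phi N (t g : set G -> G) (r : set G -> set G -> G) : rat :=
  (\sum_(K \in fixed_classes phi) Rtilde_summand phi N (t K) (g K) (r K))%R.

End AveragedTau.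

(* Main.v *)
(* Everything reduces to tau(iota_d chi) = tau(chi) for an endomorphism chi   *)
(* of D and d in D.  If the factor det(I - chi_0) of the abelianisation       *)
(* vanishes, both sides are 0.  Otherwise d^m = x chi(x)^-1 modulo the        *)
(* isolated derived subgroup H, for some m > 0 and x in D.  On a factor       *)
(* F_i / F_(i+1), on which H acts trivially, write P_e for the action of      *)
(* iota_e and M for that of chi; the P_e commute, and P_e M = M P_(chi e).    *)
(* Then (M P_d)^k = M^k Q with Q = P_e, e = d chi(d) ... chi^(k-1)(d), and    *)
(* M^k Q^m is conjugate to M^k by P_x, which commutes with Q.  By the         *)
(* condition on the eigenvalues of Q, Q - 1 is a multiple of Q^m - 1 by a     *)
(* polynomial in Q, so that tr(M^k Q) = tr(M^k) for all k.  Hence M P_d and M *)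
(* have the same eigenvalues and det(I - M P_d) = det(I - M).                 *)
(*                                                                            *)
(* Another choice of g_t or of t changes iota_c phi_t by a translation of the *)
(* coset c D_t and by conjugation with some h, where t' = h t h^-1; this      *)
(* permutes the terms of the sum.                                             *)

Require Import Defs.
From HB Require Import structures.
From mathcomp Require Import all_boot all_order all_algebra all_field.
From mathcomp Require Import finmap.
From mathcomp Require Import boolp classical_sets functions cardinality fsbigop.

Set Implicit Arguments.
Unset Strict Implicit.
Unset Printing Implicit Defensive.

Import Order.TTheory GRing.Theory Num.Theory.

(** * Traces and determinants of twisted matrices *)

(** All choices are controlled by [tau_twist]: composing an endomorphism of D with conjugation by an
    element of D does not change tau. Part (1) is an instance of it ([tau_lcoset]). Parts (2) and
    (3) are one statement, [Rtilde_summand_transport]: a bijection of cosets matches terms that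
    agree up to conjugation, harmless by [tau_transport], and up to a change of coset
    representative.

    [tau_twist] rests on linear algebra over [algC]: [det_sub1_twist] compares the power sums of
    eigenvalues by means of [mxtrace_twist], and [det_series_twist] supplies its data on each
    factor. A nonzero det (I - chi_0) yields m and x by Cramer's rule ([twisted_root]). The
    eigenvalue condition on N reaches the factors of D through an annihilating polynomial
    ([NR_annihilator]). *)

Section MatrixTwist.
Local Open Scope ring_scope.

Lemma trig_mxM (n : nat) (A B : 'M[algC]_n) : is_trig_mx A -> is_trig_mx B ->
  is_trig_mx (A *m B) /\ forall i, (A *m B) i i = A i i * B i i.
Proof.
move=> /is_trig_mxP At /is_trig_mxP Bt; split=> [|i].
  apply/is_trig_mxP => i j ij; rewrite mxE big1 // => k _.
  have [ik|ki] := ltnP i k; first by rewrite At ?mul0r.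
  by rewrite Bt ?mulr0 // (leq_ltn_trans ki).
rewrite mxE (bigD1 i) //= big1 ?addr0 // => k.
rewrite neq_ltn => /orP[ki|ik]; first by rewrite (Bt k) ?mulr0.
by rewrite (At _ k) ?mul0r.
Qed.

(** By Schur triangularisation: [s] is the diagonal, that is, the eigenvalues with multiplicity. *)
Lemma eigenvalue_seq (n : nat) (A : 'M[algC]_n.+1) :
  exists s : seq algC, \det (1 - A) = \prod_(a <- s) (1 - a) /\
    forall k : nat, \tr (A ^+ k) = \sum_(a <- s) a ^+ k.
Proof.
have [P /unitarymx_unit Pu] := @Schur _ _ A isT.
set B := conjmx P A => trigPA.
have Btrig : is_trig_mx B := trigPA.
have defA : A = invmx P *m B *m P.
  by rewrite /B conjumx // !mulmxA mulVmx // mul1mx mulmxKV.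
clearbody B; clear trigPA; have /is_trig_mxP B0 := Btrig.
exists [seq B i i | i <- enum 'I_n.+1]; split=> [|k].
  rewrite big_map big_enum /=.
  have -> : 1 - A = invmx P *m (1 - B) *m P.
    by rewrite mulmxBr mulmxBl mulmx1 mulVmx // -defA.
  rewrite !det_mulmx mulrAC -det_mulmx mulVmx // det1 mul1r det_trig.
    by apply: eq_bigr => i _; rewrite !mxE eqxx.
  apply/is_trig_mxP => i j ij; rewrite !mxE B0 //.
  by rewrite -val_eqE /= (ltn_eqF ij) subr0.
have AkE : A ^+ k = invmx P *m (B ^+ k) *m P.
  elim: k => [|k IHk]; first by rewrite !expr0 mulmx1 mulVmx.
  by rewrite !exprS {1}defA IHk /GRing.mul /= !mulmxA mulmxK.
have [_ BkE] : is_trig_mx (B ^+ k) /\ forall i, (B ^+ k) i i = B i i ^+ k.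
  elim: k {AkE} => [|k [IHt IHk]].
    split=> [|i]; first exact: scalar_mx_is_trig.
    by rewrite !expr0 mxE eqxx.
  rewrite exprS; have [t dE] := trig_mxM Btrig IHt; split=> // i.
  by rewrite dE IHk exprS.
rewrite AkE mxtrace_mulC mulmxA mulmxV // mul1mx big_map big_enum /=.
by apply: eq_bigr => i _; rewrite BkE.
Qed.

(* Sums of values of interpolation polynomials recover the multiplicities. *)
Lemma perm_eq_power_sums (s t : seq algC) :
  (forall k : nat, \sum_(a <- s) a ^+ k = \sum_(a <- t) a ^+ k) -> perm_eq s t.
Proof.
move=> st.
have stp (p : {poly algC}) : \sum_(a <- s) p.[a] = \sum_(a <- t) p.[a].
  under eq_bigr do rewrite horner_coef.
  under [RHS]eq_bigr do rewrite horner_coef.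
  rewrite exchange_big [RHS]exchange_big; apply: eq_bigr => i _.
  by rewrite -!mulr_sumr st.
apply/allP => z _ /=; apply/eqP.
have [L Luniq memL] : exists2 L, uniq L & L =i z :: s ++ t.
  by exists (undup (z :: s ++ t)); [exact: undup_uniq | exact: mem_undup].
(* [p] vanishes at every listed value except [z], so summing it over a list leaves [p.[z]] times the
   multiplicity of [z]. *)
pose p := \prod_(b <- rem z L) ('X - b%:P).
have pz : p.[z] != 0.
  by rewrite -rootE root_prod_XsubC mem_rem_uniq // !inE eqxx.
have p0 a : a \in s ++ t -> a != z -> p.[a] = 0.
  move=> ain az; apply/rootP.
  by rewrite root_prod_XsubC mem_rem_uniq // inE az /= memL inE ain orbT.
have count_sum (u : seq algC) : {subset u <= s ++ t} ->
    \sum_(a <- u) p.[a] = p.[z] *+ count_mem z u.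
  move=> us; rewrite (bigID (pred1 z)) /= [X in _ + X]big_seq_cond.
  rewrite [X in _ + X]big1 => [|a /andP[/us]]; last exact: p0.
  rewrite addr0 (eq_bigr (fun=> p.[z])) => [|a /eqP->//].
  by rewrite big_const_seq iter_addr_0.
have := stp p; rewrite !count_sum; first last.
- by move=> a as_; rewrite mem_cat as_.
- by move=> a at_; rewrite mem_cat at_ orbT.
exact: mulrIn.
Qed.

(** This forces every eigenvalue of [Q] that is a root of unity to be 1. Any annihilating polynomial
    is allowed, because the one at hand comes from a series of N and not from the factor on which
    [Q] acts. *)
Definition annihilated_net (n : nat) (Q : 'M[algC]_n.+1) : Prop :=
  exists2 q : {poly algC}, horner_mx Q q = 0 &
    forall (z : algC) (k : nat), (0 < k)%N -> z ^+ k = 1 -> root q z -> z = 1.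

(* [X - 1] lies in the ideal generated by [X ^ m - 1] and the annihilating    *)
(* polynomial of [Q], and [A Q ^ m] is conjugate to [A] by [R], which         *)
(* commutes with [Q].                                                         *)
Lemma mxtrace_twist (n m : nat) (A Q R R' : 'M[algC]_n.+1) : (0 < m)%N ->
  annihilated_net Q -> R \is a GRing.unit ->
  GRing.comm Q R -> GRing.comm Q R' ->
  Q ^+ m * R' = R -> R * A = A * R' -> \tr (A * Q) = \tr A.
Proof.
move=> m_gt0 [q Qq qnet] Ru QR QR' QmR RA.
pose S : {poly algC} := \sum_(i < m) 'X^i.
have S1 z : (z - 1) * S.[z] = z ^+ m - 1.
  rewrite /S horner_sum; under eq_bigr do rewrite hornerXn.
  by rewrite -subrX1.
(* A common root would be an [m]-th root of unity, hence 1 by [qnet]; but [S] takes the value [m] at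
   1. *)
have cop : coprimep S q.
  apply: Pdiv.ClosedField.root_coprimep => z Sz.
  have zm : z ^+ m = 1.
    by apply/eqP; rewrite -subr_eq0 -S1 (rootP Sz) mulr0.
  apply/negP => /(qnet z m m_gt0 zm) z1; move: Sz.
  rewrite z1 rootE /S horner_sum; under eq_bigr do rewrite hornerXn expr1n.
  by rewrite sumr_const card_ord pnatr_eq0 (gtn_eqF m_gt0).
have /Bezout_eq1_coprimepP[[u v] /= uv] := cop.
set U := horner_mx Q u.
have QE : Q - 1 = (Q ^+ m - 1) * U.
  have : ('X - 1) * (u * S + v * q) = 'X - 1 :> {poly algC} by rewrite uv mulr1.
  rewrite mulrDr [u * S]mulrC [v * q]mulrC !mulrA -subrX1.
  move/(congr1 (horner_mx Q)).
  rewrite !(rmorphD, rmorphM, rmorphN, rmorphXn, rmorph1) /=.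
  by rewrite Qq mulr0 mul0r addr0 horner_mx_X => ->.
have UR : U * R = R * U by apply: comm_horner_mx.
(* As [R] commutes with [U], this conjugacy gives tr (A Q^m U) = tr (A U), which is the claim in
   view of [QE]. *)
have QmA : A * Q ^+ m = R^-1 * A * R.
  rewrite -[LHS](mulKr Ru) [R * _]mulrA RA -[A * R' * _]mulrA -mulrA.
  by congr (_ * (_ * _)); rewrite -QmR; apply: commrX; apply: commr_sym.
apply/eqP; rewrite -subr_eq0 -raddfB /= -[X in _ - X]mulr1 -mulrBr QE mulrA.
rewrite mulrBr mulr1 QmA mulrBl raddfB /= -[R^-1 * A * R * U]mulrA -UR mulrA.
rewrite [X in X - _]mxtrace_mulC.
by rewrite -[_ *m _]/(_ * _) !mulrA mulrV // mul1r subrr.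
Qed.

(** [P j] and [R j] stand for the actions of chi^j(d) and chi^j(x). Moving all [M] to the left turns
    (M P_0)^k into M^k Q with Q = P_0 ... P_(k-1), and the relations between [P] and [R] telescope
    to Q^m R_k = R_0, so that [mxtrace_twist] applies to every power. *)
Lemma det_sub1_twist (n m : nat) (M : 'M[algC]_n.+1)
    (P R : nat -> 'M[algC]_n.+1) : (0 < m)%N ->
  (forall j, P j * M = M * P j.+1) -> (forall j, R j * M = M * R j.+1) ->
  (forall i j, GRing.comm (P i) (P j)) ->
  (forall i j, GRing.comm (P i) (R j)) ->
  (forall j, R j \is a GRing.unit) ->
  (forall j, P j ^+ m * R j.+1 = R j) ->
  (forall k, annihilated_net (\prod_(j < k) P j)) ->
  \det (1 - M * P 0%N) = \det (1 - M).
Proof.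
move=> m_gt0 PM RM PP PR Ru PmR net.
have [s [-> strace]] := eigenvalue_seq (M * P 0%N).
have [t [-> ttrace]] := eigenvalue_seq M.
apply: perm_big; apply: perm_eq_power_sums => k; rewrite -strace -ttrace.
have shift l : (\prod_(j < l) P j) * M = M * \prod_(j < l) P j.+1.
  elim: l => [|l IHl]; first by rewrite !big_ord0 mulr1 mul1r.
  by rewrite !big_ord_recr /= -mulrA PM mulrA IHl mulrA.
have comm_prod (B : 'M[algC]_n.+1) l (f : nat -> nat) :
    (forall j, GRing.comm (P j) B) -> GRing.comm (\prod_(j < l) P (f j)) B.
  by move=> PB; apply: commr_sym; apply: commr_prod => j _; apply: commr_sym.
have -> : (M * P 0%N) ^+ k = M ^+ k * \prod_(j < k) P j.
  elim: k => [|k IHk]; first by rewrite !expr0 big_ord0 mul1r.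
  rewrite exprSr IHk -mulrA [_ * (M * _)]mulrA shift big_ord_recl /=.
  by rewrite exprSr -!mulrA (comm_prod (P 0%N)).
apply: (mxtrace_twist (m := m) (R := R 0%N) (R' := R k)) => //.
- exact: (comm_prod _ _ id).
- exact: (comm_prod _ _ id).
- elim: k => [|k IHk]; first by rewrite big_ord0 expr1n mul1r.
  rewrite big_ord_recr /= exprMn_comm; last exact: (comm_prod _ _ id).
  by rewrite -mulrA PmR.
- elim: k => [|k IHk]; first by rewrite !expr0 mulr1 mul1r.
  by rewrite exprSr mulrA IHk -mulrA RM mulrA.
Qed.

End MatrixTwist.

Local Open Scope classical_set_scope.
Local Open Scope group_scope.

(** * Subgroups and endomorphisms *)

Section Subgroups.
Variable G : groupType.
Implicit Types (A B K S : set G) (x y g : G) (th : G -> G).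

Lemma subgroup1 A : subgroup A -> A 1.
Proof. by case. Qed.

Lemma subgroupV A x : subgroup A -> A x -> A x^-1.
Proof. by move=> [A1 AF] Ax; rewrite -[x^-1]mul1g; apply: AF. Qed.

Lemma subgroupM A x y : subgroup A -> A x -> A y -> A (x * y).
Proof.
move=> sA Ax Ay; rewrite -[y]invgK; apply: (proj2 sA) => //.
exact: subgroupV.
Qed.

Lemma subgroupX A x n : subgroup A -> A x -> A (x ^+ n).
Proof.
move=> sA Ax; elim: n => [|n IHn]; first exact: subgroup1.
by rewrite expgS; apply: subgroupM.
Qed.

Lemma subgroup_generated S : subgroup (generated S).
Proof.
split=> [K [sK _]|x y Sx Sy K [sK SK]]; first exact: subgroup1.
by apply: (proj2 sK); [apply: Sx | apply: Sy].
Qed.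

Lemma sub_generated S : S `<=` generated S.
Proof. by move=> x Sx K [_ SK]; apply: SK. Qed.

Lemma generated_min S K : subgroup K -> S `<=` K -> generated S `<=` K.
Proof. by move=> sK SK x Sx; apply: Sx. Qed.

Lemma commutator_in A B a b : A a -> B b -> commutator_subgroup A B [~ a, b].
Proof. by move=> Aa Bb; apply: sub_generated; exists a => //; exists b. Qed.

Lemma subgroup_commutator A B : subgroup (commutator_subgroup A B).
Proof. exact: subgroup_generated. Qed.

Lemma commutator_sub A B K : subgroup K -> A `<=` K -> B `<=` K ->
  commutator_subgroup A B `<=` K.
Proof.
move=> sK AK BK; apply: generated_min => // _ [a Aa [b Bb <-]].
by rewrite commgEl; do !apply: subgroupM => //; do ?apply: subgroupV => //;
  auto.
Qed.

Lemma lower_centralSS A i :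
  lower_central A i.+2 = commutator_subgroup (lower_central A i.+1) A.
Proof. by []. Qed.

Lemma subgroup_lower_central A i : subgroup A -> subgroup (lower_central A i).
Proof. by case: i => [|[|i]] // _; exact: subgroup_generated. Qed.

Lemma lower_central_sub A i : subgroup A -> lower_central A i `<=` A.
Proof.
move=> sA; case: i => [|i] //; elim: i => [|i IHi] //.
by rewrite lower_centralSS; apply: commutator_sub.
Qed.

Section Morphism.
Variable th : G -> G.
Hypothesis thM : {morph th : x y / x * y}.

Lemma morph_fun1 : th 1 = 1.
Proof. by apply: (mulgI (th 1)); rewrite -thM !mulg1. Qed.

Lemma morph_funV : {morph th : x / x^-1}.
Proof.
by move=> x; apply: (mulgI (th x)); rewrite -thM !mulgV morph_fun1.
Qed.

Lemma morph_funX n : {morph th : x / x ^+ n}.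
Proof.
move=> x; elim: n => [|n IHn]; first by rewrite !expg0 morph_fun1.
by rewrite !expgS thM IHn.
Qed.

Lemma generated_morph S S' : (forall x, S x -> generated S' (th x)) ->
  forall x, generated S x -> generated S' (th x).
Proof.
move=> SS'; apply: (@generated_min S (th @^-1` generated S')) => //.
have sS' := subgroup_generated S'.
split=> [|x y Sx Sy].
  by rewrite /preimage /= morph_fun1; apply: subgroup1.
by rewrite /preimage /= thM morph_funV; apply: (proj2 sS').
Qed.

Lemma commutator_morph A A' B B' :
  (forall x, A x -> A' (th x)) -> (forall x, B x -> B' (th x)) ->
  forall x, commutator_subgroup A B x -> commutator_subgroup A' B' (th x).
Proof.
move=> AA' BB'; apply: generated_morph => _ [a Aa [b Bb <-]].
have -> : th [~ a, b] = [~ th a, th b].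
  by rewrite !commgEl !conjgE !(thM, morph_funV).
by apply: commutator_in; auto.
Qed.

Lemma lower_central_morph A A' i : (forall x, A x -> A' (th x)) ->
  forall x, lower_central A i x -> lower_central A' i (th x).
Proof.
move=> AA'; case: i => [|i] //; elim: i => [|i IHi] //.
by rewrite !lower_centralSS; apply: commutator_morph.
Qed.

Lemma isolator_morph A A' B B' :
  (forall x, A x -> A' (th x)) -> (forall x, B x -> B' (th x)) ->
  forall x, isolator A B x -> isolator A' B' (th x).
Proof.
move=> AA' BB' x [Ax [k k_gt0 Bxk]]; split; first exact: AA'.
by exists k => //; rewrite -morph_funX; apply: BB'.
Qed.

Lemma isolated_derived_morph A A' : (forall x, A x -> A' (th x)) ->
  forall x, isolated_derived A x -> isolated_derived A' (th x).
Proof.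
by move=> AA'; apply: isolator_morph => //; apply: commutator_morph.
Qed.

(** For [A' = A] this is full invariance of the terms; the form with two groups also carries the
    series along a conjugation. *)
Lemma tau_series_morph A A' i : (forall x, A x -> A' (th x)) ->
  forall x, tau_series A i x -> tau_series A' i (th x).
Proof.
move=> AA'; case: i => [|i] //; apply: isolator_morph.
  exact: isolated_derived_morph.
by apply: lower_central_morph; apply: isolated_derived_morph.
Qed.

End Morphism.

Lemma innerM g : {morph inner g : x y / x * y}.
Proof. by move=> x y; rewrite /inner !mulgA mulgVK. Qed.

Lemma innerMl g h x : inner (g * h) x = inner g (inner h x).
Proof. by rewrite /inner invgM !mulgA. Qed.

Lemma inner1 x : inner 1 x = x.
Proof. by rewrite /inner mul1g invg1 mulg1. Qed.

Lemma innerK g : cancel (inner g) (inner g^-1).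
Proof. by move=> x; rewrite -innerMl mulVg inner1. Qed.

Lemma innerKV g : cancel (inner g^-1) (inner g).
Proof. by move=> x; rewrite -innerMl mulgV inner1. Qed.

Lemma inner_morph th g x : {morph th : x y / x * y} ->
  th (inner g x) = inner (th g) (th x).
Proof. by move=> thM; rewrite /inner !thM (morph_funV thM). Qed.

Lemma inner_in A g x : subgroup A -> A g -> A x -> A (inner g x).
Proof. by move=> sA Ag Ax; do !apply: subgroupM => //; apply: subgroupV. Qed.

Lemma commute_inner x t : commute x t <-> inner x t = t.
Proof.
rewrite /inner /commute; split=> [->|xt]; first by rewrite mulgK.
by rewrite -[in RHS]xt mulgVK.
Qed.

Lemma isolated_derived_sub A : isolated_derived A `<=` A.
Proof. by move=> x []. Qed.

(** Modulo the commutator subgroup, taking powers is multiplicative, so the product of the exponents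
    of two elements serves for their quotient. *)
Lemma subgroup_isolated_derived A : subgroup A -> subgroup (isolated_derived A).
Proof.
move=> sA; set C := commutator_subgroup A A.
have sC : subgroup C := subgroup_commutator A A.
have CA : C `<=` A by apply: commutator_sub.
have CJ g x : A g -> C x -> C (inner g x).
  move=> Ag Cx; apply: (commutator_morph (innerM g) _ _ Cx) => y;
    exact: inner_in.
have expMC x y n : A x -> A y ->
    exists2 c, C c & (x * y) ^+ n = c * (x ^+ n * y ^+ n).
  move=> Ax Ay; elim: n => [|n [c Cc IHn]].
    by exists 1; [apply: subgroup1 | rewrite !expg0 !mulg1].
  have Cd : C (inner (x ^+ n) [~ (y ^+ n)^-1, x^-1]).
    by apply: CJ; [exact: subgroupX | apply: commutator_in];
      do !apply: subgroupV => //; apply: subgroupX.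
  exists (c * inner (x ^+ n) [~ (y ^+ n)^-1, x^-1]).
    exact: (subgroupM sC).
  by rewrite expgSr IHn /inner commgEl conjgE !invgK !expgSr !mulgA !mulgVK.
split=> [|x y [Ax [k k_gt0 Cx]] [Ay [l l_gt0 Cy]]].
  by split; [exact: subgroup1 | exists 1%N => //; exact: subgroup1].
split; first exact: (proj2 sA).
exists (k * l)%N; first by rewrite muln_gt0 k_gt0.
have [c Cc ->] := expMC x y^-1 (k * l)%N Ax (subgroupV sA Ay).
apply: (subgroupM sC) => //; apply: (subgroupM sC).
  by rewrite expgnA; apply: (subgroupX _ sC).
by rewrite expVgn mulnC expgnA; apply: (subgroupV sC); apply: (subgroupX _ sC).
Qed.

End Subgroups.

(** * Induced matrices *)

Section PolynomialAction.
Variable G : groupType.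
Implicit Types (A B S T : set G) (x y e g : G) (th : G -> G).

Definition zpow x (z : int) : G :=
  match z with Posz n => x ^+ n | Negz n => x ^- n.+1 end.

Definition additive_on (n : nat) T (f : G -> 'rV[int]_n) : Prop :=
  forall x y, T x -> T y -> f (x * y) = (f x + f y)%R.

Lemma subgroup_zpow T x z : subgroup T -> T x -> T (zpow x z).
Proof.
by move=> sT Tx; case: z => n /=; [|apply: (subgroupV sT)];
  apply: (subgroupX _ sT).
Qed.

Section AdditiveOn.
Variables (n : nat) (T : set G) (f : G -> 'rV[int]_n).
Hypotheses (sT : subgroup T) (fD : additive_on T f).

Lemma additive_on1 : f 1 = 0%R.
Proof.
have T1 := subgroup1 sT.
by apply: (addrI (f 1)); rewrite -fD // mulg1 addr0.
Qed.

Lemma additive_onV x : T x -> f x^-1 = (- f x)%R.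
Proof.
move=> Tx; apply: (addrI (f x)).
by rewrite -fD ?mulgV ?additive_on1 ?subrr //; apply: (subgroupV sT).
Qed.

Lemma additive_onX x k : T x -> f (x ^+ k) = (f x *+ k)%R.
Proof.
move=> Tx; elim: k => [|k IHk]; first by rewrite expg0 additive_on1.
by rewrite expgS fD ?IHk ?mulrS //; apply: (subgroupX _ sT).
Qed.

Lemma additive_on_zpow x z : T x -> f (zpow x z) = (z *: f x)%R.
Proof.
move=> Tx; case: z => k /=.
  by rewrite additive_onX // -scaler_nat pmulrn intz.
rewrite additive_onV ?additive_onX // -?scaler_nat ?pmulrn ?intz.
  by rewrite NegzE scaleNr.
exact: (subgroupX _ sT).
Qed.

Lemma additive_on_prod (I : Type) (r : seq I) (F : I -> G) :
  (forall i, T (F i)) ->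
  T (\prod_(i <- r) F i) /\ f (\prod_(i <- r) F i) = (\sum_(i <- r) f (F i))%R.
Proof.
move=> TF; elim: r => [|i r [IHT IHf]].
  by rewrite !big_nil; split; [exact: subgroup1 | exact: additive_on1].
rewrite !big_cons; split; first exact: (subgroupM sT).
by rewrite fD // IHf.
Qed.

End AdditiveOn.

(* [y] is the value at [x] of the polynomial [q] in the operator [inner e],   *)
(* written multiplicatively; it is not unique when conjugates of [x] do not   *)
(* commute.                                                                   *)
Definition poly_image e (q : {poly int}) x y : Prop :=
  forall S, subgroup S -> (forall z, S z -> S (inner e z)) -> S x ->
    S y /\ forall (n : nat) (f : G -> 'rV[int]_n.+1) (P : 'M[int]_n.+1),
      additive_on S f -> induced_matrix S (inner e) f P ->
      f y = (f x *m horner_mx P q)%R.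

(** Horner's scheme, with X acting as [inner e] and a constant as a power of [x]. The construction
    does not mention [S] or [f], so one [y] serves for all of them. *)
Lemma poly_image_exists e q x : exists y, poly_image e q x y.
Proof.
elim/poly_ind: q => [|q c [y IHy]].
  exists 1 => S sS Se Sx; split=> [|n f P fD fP]; first exact: subgroup1.
  by rewrite rmorph0 mulmx0 (additive_on1 sS fD).
exists (inner e y * zpow x c) => S sS Se Sx.
have [Sy fy] := IHy S sS Se Sx; have Sey := Se _ Sy.
have Szx := subgroup_zpow c sS Sx.
split=> [|n f P fD fP]; first exact: (subgroupM sS).
rewrite rmorphD rmorphM /= horner_mx_X horner_mx_C fD // fP //.
rewrite (fy n f P fD fP) (additive_on_zpow sS fD) //.
by rewrite mulmxDr mulmxA mul_mx_scalar.
Qed.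

Lemma poly_image_refl e x : poly_image e 1%R x x.
Proof. by move=> S sS Se Sx; split=> // n f P _ _; rewrite rmorph1 mulmx1. Qed.

Lemma poly_image_trans e p q x y z :
  poly_image e p x y -> poly_image e q y z -> poly_image e (p * q)%R x z.
Proof.
move=> xy yz S sS Se Sx; have [Sy fy] := xy S sS Se Sx.
have [Sz fz] := yz S sS Se Sy; split=> // n f P fD fP.
by rewrite (fz n f P fD fP) (fy n f P fD fP) rmorphM /= mulmxA.
Qed.

(* The isolators of the series are not known to be subgroups; computations    *)
(* take place in [T], which [A] isolates.                                     *)
Definition isolated_by A T : Prop :=
  [/\ subgroup T, T `<=` A, forall x k, A x -> A (x ^+ k) &
      forall x, A x -> exists2 k : nat, (0 < k)%N & T (x ^+ k)].

Lemma isolated_by_refl A : subgroup A -> isolated_by A A.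
Proof.
move=> sA; split=> // [x k|x Ax]; first exact: subgroupX.
by exists 1%N.
Qed.

Lemma factor_coordsX A B n (f : G -> 'rV[int]_n) x k :
  factor_coords A B f -> (forall l, A (x ^+ l)) -> f (x ^+ k) = (f x *+ k)%R.
Proof.
move=> [fD _ _] Ax; have A1 := Ax 0%N; have A1' := Ax 1%N.
elim: k => [|k IHk].
  by apply: (addrI (f 1)); rewrite expg0 mulr0n addr0 -fD // mulg1.
by rewrite expgS fD // IHk mulrS.
Qed.

Lemma mulrnI_mx n (u v : 'rV[int]_n) k :
  (0 < k)%N -> (u *+ k = v *+ k)%R -> u = v.
Proof.
move=> k_gt0 uv; apply/matrixP => i j; move/matrixP/(_ i j): uv.
by rewrite !mulmxnE; apply: pmulrnI.
Qed.

(** The rows are the images of lifts [b j] of the standard basis. Since [A] is not known to be a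
    subgroup, [x] is compared with a product of the [b j] only after raising everything to a power
    inside [T]; the exponent cancels in Z^n. *)
Lemma induced_matrix_exists A B T n (f : G -> 'rV[int]_n) th :
  isolated_by A T -> factor_coords A B f -> {morph th : x y / x * y} ->
  (forall x, A x -> A (th x)) -> (forall x, B x -> B (th x)) ->
  (forall x, T x -> T (th x)) -> exists M, induced_matrix A th f M.
Proof.
move=> [sT TA AX Aroot] fc thM Ath Bth Tth.
have [fD fsurj fker] := fc.
have fT : additive_on T f by move=> x y Tx Ty; apply: fD; apply: TA.
have fthT : additive_on T (f \o th).
  by move=> x y Tx Ty /=; rewrite thM fT //; apply: Tth.
have /choice[b bP] : forall j : 'I_n, exists y, A y /\ f y = delta_mx 0%R j.
  by move=> j; have [y Ay fy] := fsurj (delta_mx 0%R j); exists y.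
have /choice[k kP] : forall j, exists k : nat, (0 < k)%N /\ T (b j ^+ k).
  by move=> j; have [k k_gt0 Tk] := Aroot _ (proj1 (bP j)); exists k.
exists (\matrix_j f (th (b j)))%R => x Ax.
have [k0 k0_gt0 Tx] := Aroot x Ax.
set K := (k0 * \prod_(j < n) k j)%N.
have K_gt0 : (0 < K)%N.
  by rewrite muln_gt0 k0_gt0 prodn_gt0 // => j; have [] := kP j.
have TxK : T (x ^+ K) by rewrite /K expgnA; apply: (subgroupX _ sT).
have TbK j : T (b j ^+ K).
  rewrite /K (bigD1 j) //= mulnCA expgnA; apply: (subgroupX _ sT).
  by have [] := kP j.
(* By design [f y = f (x ^+ K)], so [x ^+ K * y^-1] lies in [B], which [th] preserves; hence [th y]
   and [th (x ^+ K)] have the same coordinates. *)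
pose y := \prod_(j <- enum 'I_n) zpow (b j ^+ K) (f x 0%R j).
have TbKz j : T (zpow (b j ^+ K) (f x 0%R j)) by apply: subgroup_zpow.
have [Ty fy] := additive_on_prod sT fT (enum 'I_n) TbKz.
have [_ fthy] := additive_on_prod sT fthT (enum 'I_n) TbKz.
rewrite -/y in Ty fy fthy.
have {}fy : f y = (f x *+ K)%R.
  rewrite fy [in RHS](row_sum_delta (f x)) -sumrMnl big_enum.
  apply: eq_bigr => j _.
  rewrite (additive_on_zpow sT fT) //.
  rewrite (factor_coordsX _ fc) => [|l]; last by apply: AX; case: (bP j).
  by case: (bP j) => _ ->; rewrite -scalerMnr.
have fthX z l : A z -> f (th z ^+ l) = (f (th z) *+ l)%R.
  by move=> Az; rewrite (factor_coordsX _ fc) // => ?; apply: AX; apply: Ath.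
have {}fthy : f (th y) = (f x *m \matrix_j f (th (b j)) *+ K)%R.
  rewrite [LHS]fthy mulmx_sum_row -sumrMnl big_enum; apply: eq_bigr => j _.
  rewrite (additive_on_zpow sT fthT) // rowK /= (morph_funX thM) fthX.
    by rewrite scalerMnr.
  by case: (bP j).
have Tz : T (x ^+ K * y^-1) by apply: (proj2 sT).
apply: (@mulrnI_mx _ _ _ K) => //; rewrite -fthy -fthX // -(morph_funX thM).
apply/eqP; rewrite -subr_eq0; apply/eqP.
have TthyV : T (th y)^-1 by apply: (subgroupV sT); apply: Tth.
rewrite -(additive_onV sT fT) -?fT //; try exact: Tth.
rewrite -(morph_funV thM) -thM; apply/fker; first by apply/Ath/TA.
apply: Bth; apply/fker; first exact: TA.
by rewrite fT ?(additive_onV sT fT) ?fy ?(factor_coordsX _ fc) ?subrr //;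
  [move=> l; exact: AX | exact: (subgroupV sT)].
Qed.

Lemma induced_matrix_inj A B n (f : G -> 'rV[int]_n) (P Q : 'M[int]_n) :
  factor_coords A B f -> (forall x, A x -> f x *m P = f x *m Q)%R -> P = Q.
Proof.
move=> [_ fsurj _] PQ; apply/row_matrixP => j; rewrite !rowE.
by have [x Ax <-] := fsurj (delta_mx 0%R j); apply: PQ.
Qed.

End PolynomialAction.

(** * Invariance of tau under inner automorphisms *)

Section Twist.
Variable G : groupType.
Implicit Types (A B S T N D : set G) (x y e g d h : G) (chi : G -> G).

Definition net_poly (q : {poly int}) : Prop :=
  forall (z : algC) (k : nat), (0 < k)%N -> (z ^+ k = 1)%R ->
    root (map_poly intr q) z -> z = 1%R.

(* The product of the characteristic polynomials of [inner e] on the factors  *)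
(* of the given series of [N] kills the isolated derived subgroup, hence      *)
(* every torsion-free abelian section of it.                                  *)
Lemma NR_annihilator N e : NR_group N -> N e ->
  exists2 q : {poly int}, net_poly q &
    forall S, subgroup S -> S `<=` isolated_derived N ->
    (forall x, S x -> S (inner e x)) ->
    forall (n : nat) (f : G -> 'rV[int]_n.+1) (P : 'M[int]_n.+1),
    additive_on S f -> induced_matrix S (inner e) f P ->
    forall x, S x -> (f x *m horner_mx P q = 0)%R.
Proof.
move=> [_ _ [c [Hs [Hs1 HsE Hsnormal Hsfactor]]]] Ne.
have Hse i z : (1 <= i <= c.+1)%N -> Hs i z -> Hs i (inner e z).
  by move=> /Hsnormal[_ _]; apply.
have [q qnet qP] : exists2 q, net_poly q &
    forall x, Hs 1%N x -> exists2 y, Hs c.+1 y & poly_image e q x y.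
  (* Induction on the number [i] of factors already passed: [q] pushes [Hs 1] into [Hs i.+1]. *)
  elim: {-2}c (leqnn c) => [|i IHi] ic.
    exists 1%R => [z k _ _|x Hx]; first by rewrite rmorph1 (negPf (root1 _)).
    by exists x => //; exact: poly_image_refl.
  have [q qnet qP] := IHi (ltnW ic).
  have [HsS _ [n [f fc]] Hnet] := Hsfactor i.+1 ic.
  have iP : (1 <= i.+1 <= c.+1)%N by rewrite /= leqW.
  have [sH _ _] := Hsnormal i.+1 iP.
  have [M fM] := induced_matrix_exists (isolated_by_refl sH) fc (innerM e)
    (fun x => Hse _ x iP) (fun x => Hse i.+2 x ic) (fun x => Hse _ x iP).
  have [fD _ fker] := fc.
  exists (q * char_poly M)%R => [z k k_gt0 zk|x /qP[y Hy xy]].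
    rewrite rmorphM rootM /= => /orP[|]; first exact: qnet k_gt0 zk.
    rewrite map_char_poly -eigenvalue_root_char.
    exact: (Hnet e Ne n f M fc fM) k_gt0 zk.
  (* By Cayley-Hamilton, [z] has coordinates 0 and thus lies one step further down the series. *)
  have [z yz] := poly_image_exists e (char_poly M) y.
  exists z; last exact: poly_image_trans xy yz.
  have [Hz fz] := yz _ sH (fun x => Hse _ x iP) Hy.
  apply/fker => //; clear yz; case: n => [|n] in f M fc fM fD {fker} fz *.
    by apply/matrixP => ? [].
  by rewrite (fz n f M fD fM) Cayley_Hamilton mulmx0.
exists q => // S sS SN Se n f P fD fP x Sx.
(* The end of the series is trivial, so 1 is the image of [x] under [q], and its coordinates in any
   section are 0. *)
have [|y] := qP x; first by rewrite Hs1; apply: SN.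
rewrite HsE => -> /(_ S sS Se Sx)[_ /(_ n f P fD fP) <-].
exact: additive_on1 fD.
Qed.

Section FactorTwist.
Variables (N D : set G) (chi : G -> G).
Hypotheses (N_NR : NR_group N) (sD : subgroup D) (DN : D `<=` N).
Hypotheses (chiM : {morph chi : x y / x * y}).
Hypothesis chiD : forall x, D x -> D (chi x).

Let H := isolated_derived D.

Let sH : subgroup H. Proof. exact: subgroup_isolated_derived. Qed.

Let innerD e : D e -> forall x, D x -> D (inner e x).
Proof. by move=> De x; apply: inner_in. Qed.

Variables (i n : nat) (f : G -> 'rV[int]_n.+1).
(** The shift by one leaves out the factor at 0, which [tau_twist] treats apart. *)
Let A := tau_series D i.+1.
Let B := tau_series D i.+2.
Let T := lower_central H i.+1.
Hypothesis fc : factor_coords A B f.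

Let isoT : isolated_by A T.
Proof.
have sT : subgroup T by apply: subgroup_lower_central.
split=> // [x Tx|x k [Hx [l l_gt0 Txl]]|x []//].
  by split; [exact: (lower_central_sub sH Tx) | exists 1%N].
split; first exact: (subgroupX _ sH).
by exists l => //; rewrite expgnAC; apply: (subgroupX _ sT).
Qed.

Lemma series_matrix_exists th : {morph th : x y / x * y} ->
  (forall x, D x -> D (th x)) -> exists M, induced_matrix A th f M.
Proof.
move=> thM thD; apply: (induced_matrix_exists isoT fc thM).
- exact: tau_series_morph.
- exact: tau_series_morph.
- by apply: lower_central_morph => //; exact: isolated_derived_morph.
Qed.

(** On gamma_(i+1)(H), conjugation by [h] changes an element by a commutator in gamma_(i+2)(H).
    Elements of [A] have powers there, and Z^n is torsion-free. *)
Lemma isolated_derived_acts_trivially h x : H h -> A x -> f (inner h x) = f x.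
Proof.
move=> Hh Ax; have [sT TA AX Aroot] := isoT; have [fD _ fker] := fc.
have Dh := isolated_derived_sub Hh.
have fT : additive_on T f by move=> y z Ty Tz; apply: fD; apply: TA.
have hT z : T z -> T (inner h z).
  by apply: (lower_central_morph (innerM h)) => y; apply: inner_in.
have trivT z : T z -> f (inner h z) = f z.
  move=> Tz; have Bc : T (z^-1 * inner h z).
    by apply: (subgroupM sT); [apply: (subgroupV sT) | apply: hT].
  rewrite -[inner h z](mulVKg z) fT // [X in (_ + X)%R](_ : _ = 0%R) ?addr0 //.
  apply/fker; first exact: TA.
  have cT : lower_central H i.+2 (z^-1 * inner h z).
    have -> : z^-1 * inner h z = [~ z, h^-1].
      by rewrite commgEl conjgE invgK /inner !mulgA.
    by rewrite lower_centralSS; apply: commutator_in => //; apply: subgroupV.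
  by split; [exact: (lower_central_sub sH cT) | exists 1%N].
have [k k_gt0 Txk] := Aroot x Ax.
apply: (@mulrnI_mx _ _ _ k) => //.
have Ah : A (inner h x).
  by apply: (tau_series_morph (innerM h)) Ax; apply: innerD.
have Xx y : A y -> f (y ^+ k) = (f y *+ k)%R.
  by move=> Ay; apply: (factor_coordsX _ fc) => l; apply: AX.
by rewrite -!Xx // -(morph_funX (innerM h)) trivT.
Qed.

Variable M : 'M[int]_n.+1.
Hypothesis fM : induced_matrix A chi f M.

(** The condition reads d^m = x chi(x)^-1 modulo H. As H acts trivially and D / H is abelian, the
    matrices [P e] commute and the congruence becomes an identity between them, as [det_sub1_twist]
    requires. *)
Lemma det_series_twist d x m : (0 < m)%N -> D d -> D x ->
  H (x^-1 * d ^+ m * chi x) ->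
  exists2 M', induced_matrix A (inner d \o chi) f M' &
    (\det (1%:M - M') = \det (1%:M - M))%R.
Proof.
move=> m_gt0 Dd Dx Hdx.
have chiA z : A z -> A (chi z) by apply: tau_series_morph.
have innerA e : D e -> forall z, A z -> A (inner e z).
  by move=> De; apply: (tau_series_morph (innerM e)); apply: innerD.
have /choice[P Pe] : forall e, exists P, D e -> induced_matrix A (inner e) f P.
  move=> e; have [De|nDe] := pselect (D e); last by exists 0%R.
  have [P fP] := series_matrix_exists (innerM e) (innerD De).
  by exists P.
exists (M *m P d)%R.
  by move=> z Az /=; rewrite Pe ?fM ?mulmxA //; exact: chiA.
have uniq_mx := induced_matrix_inj fc.
(* Matrices act on row vectors, which reverses the order of composition. *)
have PM e e' : D e -> D e' -> P (e * e') = (P e' * P e)%R.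
  move=> De De'; apply: uniq_mx => z Az.
  rewrite -(Pe _ (subgroupM sD De De')) // innerMl Pe ?Pe ?mulmxA //.
  exact: innerA.
have PH h : H h -> P h = 1%R.
  move=> Hh; apply: uniq_mx => z Az; have Dh := isolated_derived_sub Hh.
  by rewrite -Pe // mulmx1 isolated_derived_acts_trivially.
have DV e : D e -> D e^-1 by apply: subgroupV.
have PV e : D e -> (P (e^-1)%g * P e = 1)%R.
  move=> De; rewrite -PM ?mulgV ?PH //; try exact: DV.
  exact: subgroup1.
have PC e e' : D e -> D e' -> GRing.comm (P e) (P e').
  move=> De De'; rewrite /GRing.comm -!PM // [e * e']commgC.
  have HC : H [~ e, e'].
    split; last by exists 1%N => //; apply: commutator_in.
    by apply: (commutator_sub sD _ _ (commutator_in De De')).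
  have DC := isolated_derived_sub HC.
  by rewrite [RHS]PM ?(PH _ HC) ?mul1r //; apply: (subgroupM sD).
have PX e k : D e -> P (e ^+ k) = (P e ^+ k)%R.
  move=> De; elim: k => [|k IHk].
    by rewrite expg0 expr0 PH //; apply: subgroup1.
  by rewrite expgS PM ?IHk ?exprSr //; apply: (subgroupX _ sD).
have Pchi e : D e -> (P e * M = M * P (chi e))%R.
  move=> De; apply: uniq_mx => z Az; rewrite -!mulmxE !mulmxA.
  transitivity (f (chi (inner e z))); first by rewrite fM ?Pe //; exact: innerA.
  by rewrite inner_morph // Pe ?fM //; [exact: chiD | exact: chiA].
have iterD k y : D y -> D (iter k chi y).
  by move=> Dy; elim: k => //= k; apply: chiD.
have iterH k y : H y -> H (iter k chi y).
  by move=> Hy; elim: k => //= k; apply: isolated_derived_morph.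
have iterM k : {morph iter k chi : y z / y * z}.
  by move=> y z; elim: k => //= k ->; rewrite chiM.
pose toC := map_mx intr : 'M[int]_n.+1 -> 'M[algC]_n.+1.
have toCM : {morph toC : U V / (U * V)%R} by move=> U V; apply: map_mxM.
have toC1 : toC 1%R = 1%R by apply: map_mx1.
have toCX k U : toC (U ^+ k)%R = (toC U ^+ k)%R.
  by elim: k => [|k IHk]; rewrite ?expr0 // !exprS toCM IHk.
have toC_comm U V : GRing.comm U V -> GRing.comm (toC U) (toC V).
  by move=> UV; rewrite /GRing.comm -!toCM UV.
have detC U : (\det (1%:M - toC U) = (\det (1%:M - U))%:~R)%R.
  by rewrite -det_map_mx map_mxB map_mx1.
apply: (@intr_inj algC); rewrite -!detC toCM.
apply: (@det_sub1_twist _ m _ (fun j => toC (P (iter j chi d)))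
                              (fun j => toC (P (iter j chi x)))) => //.
- by move=> j; rewrite -!toCM Pchi //; apply: iterD.
- by move=> j; rewrite -!toCM Pchi //; apply: iterD.
- by move=> j k; apply: toC_comm; apply: PC; apply: iterD.
- by move=> j k; apply: toC_comm; apply: PC; apply: iterD.
- move=> j; have := PV _ (iterD j _ Dx) => /(congr1 toC).
  by rewrite toCM toC1 => /mulmx1_unit[].
- move=> j /=; rewrite -toCX -toCM -PX; last exact: iterD.
  set dj := iter j chi d; set xj := iter j chi x.
  have Ddj : D dj by apply: iterD.
  have Dxj : D xj by apply: iterD.
  (* The image of the congruence under chi^j gives the relation at index [j]. *)
  have /(iterH j) := Hdx; rewrite !iterM -[iter j chi (chi x)]iterSr /=.
  rewrite (morph_funV (iterM j)) (morph_funX (iterM j)) -/dj -/xj => Hh.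
  have Ddm : D (dj ^+ m) by apply: subgroupX.
  rewrite PC //; last exact: chiD.
  rewrite -PM //; last exact: chiD.
  have -> : dj ^+ m * chi xj = xj * (xj^-1 * dj ^+ m * chi xj).
    by rewrite !mulgA mulgV mul1g.
  rewrite PM ?(PH _ Hh) ?mul1r //.
  exact: isolated_derived_sub Hh.
- move=> k.
  (* The product is again a single [P e] with [e] in D, so the eigenvalue condition for elements of
     N applies to it. *)
  have [e De ->] : exists2 e, D e &
      (\prod_(j < k) toC (P (iter j chi d)) = toC (P e))%R.
    elim: k => [|k [e De IHk]].
      exists 1; first exact: subgroup1.
      by rewrite big_ord0 PH ?toC1 //; apply: subgroup1.
    exists (iter k chi d * e).
      by apply: (subgroupM sD) => //; apply: iterD.
    by rewrite big_ord_recr /= IHk -toCM -PM //; apply: iterD.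
  have [q qnet qe] := NR_annihilator N_NR (DN De).
  exists (map_poly intr q); last exact: qnet.
  rewrite -map_horner_mx; suff -> : horner_mx (P e) q = 0%R by rewrite map_mx0.
  have [sT TA AX Aroot] := isoT; have [fD _ _] := fc.
  apply: uniq_mx => z Az; rewrite mulmx0.
  have [l l_gt0 Tzl] := Aroot z Az; apply: (@mulrnI_mx _ _ _ l) => //.
  rewrite mul0rn -scaler_nat scalemxAl scaler_nat.
  rewrite -(factor_coordsX _ fc); last by move=> ?; apply: AX.
  apply: (qe T) => //.
  + move=> y /(lower_central_sub sH).
    exact: (isolated_derived_morph (th := id)).
  + apply: (lower_central_morph (innerM e)) => y.
    apply: isolated_derived_morph => //.
    * exact: innerM.
    * exact: innerD.
  + by move=> y y' Ty Ty'; apply: fD; apply: TA.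
  + by move=> y Ty; apply: Pe => //; apply: TA.
Qed.

End FactorTwist.

Section TauTwist.
Variables (N D : set G).
Hypotheses (N_NR : NR_group N) (sD : subgroup D) (DN : D `<=` N).

Lemma tau_series1_sub : tau_series D 1 `<=` isolated_derived D.
Proof. by move=> x []. Qed.

Lemma abelianisation_twist n (f : G -> 'rV[int]_n) d x :
  factor_coords D (tau_series D 1) f -> D d -> D x -> f (inner d x) = f x.
Proof.
move=> [fD _ _] Dd Dx; have DdV := subgroupV sD Dd.
have f1 := additive_on1 sD fD.
rewrite /inner !fD ?(additive_onV sD fD) //; last exact: (subgroupM sD).
by rewrite [(f d + _)%R]addrC addrK.
Qed.

(** Cramer's rule on the abelianisation: f(d) adj(I - M) is mapped by I - M to a multiple of f(d) by
    the determinant. *)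
Lemma twisted_root chi d n (f : G -> 'rV[int]_n) (M : 'M[int]_n) :
  (forall x, D x -> D (chi x)) -> D d ->
  factor_coords D (tau_series D 1) f -> induced_matrix D chi f M ->
  (\det (1%:M - M) != 0)%R ->
  exists m x, [/\ (0 < m)%N, D x & isolated_derived D (x^-1 * d ^+ m * chi x)].
Proof.
move=> chiD Dd fc fM det0; have [fD fsurj fker] := fc.
set a := (\det (1%:M - M))%R in det0.
(* The sign makes the exponent of [d] the natural number [|a|]. *)
have [x Dx fx] := fsurj (sgz a *: (f d *m \adj (1%:M - M)))%R.
have DxV := subgroupV sD Dx; have Ddm : D (d ^+ `|a|%N) by apply: subgroupX.
exists `|a|%N, x; split=> //; first by rewrite absz_gt0.
have Dxd := subgroupM sD DxV Ddm; have Dcx := chiD x Dx.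
apply: tau_series1_sub; apply/fker.
  exact: (subgroupM sD).
rewrite !fD //.
rewrite (additive_onV sD fD) // (additive_onX sD fD) // fM //.
suff -> : (f d *+ `|a|%N = f x *m (1%:M - M))%R.
  by rewrite mulmxBr mulmx1 addrA addNr add0r addNr.
rewrite fx -scalemxAl -mulmxA mul_adj_mx mul_mx_scalar scalerA -/a.
by rewrite mulrC -[(a * _)%R]mulrC -normrEsg -scaler_nat natz abszE.
Qed.

(** One inclusion between the sets of values from which [factor_absdet] chooses; the converse is the
    same lemma for d^-1. Equal sets give equal choices, so determinants in different coordinates are
    never compared. *)
Lemma tau_twist_sub chi d i v n0 (f0 : G -> 'rV[int]_n0) (M0 : 'M[int]_n0) :
  {morph chi : x y / x * y} -> (forall x, D x -> D (chi x)) -> D d ->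
  factor_coords D (tau_series D 1) f0 -> induced_matrix D chi f0 M0 ->
  (\det (1%:M - M0) != 0)%R ->
  (exists n (f : G -> 'rV[int]_n) M,
    [/\ factor_coords (tau_series D i.+1) (tau_series D i.+2) f,
        induced_matrix (tau_series D i.+1) chi f M &
        v = `|(\det (1%:M - M))%R|%N]) ->
  exists n (f : G -> 'rV[int]_n) M,
    [/\ factor_coords (tau_series D i.+1) (tau_series D i.+2) f,
        induced_matrix (tau_series D i.+1) (inner d \o chi) f M &
        v = `|(\det (1%:M - M))%R|%N].
Proof.
move=> chiM chiD Dd fc0 fM0 det0 [n [f [M [fc fM ->]]]].
have [m [x [m_gt0 Dx Hx]]] := twisted_root chiD Dd fc0 fM0 det0.
case: n => [|n] in f M fc fM *.
  by exists 0%N, f, M; split=> // z _; apply/matrixP => ? [].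
have [M' fM' <-] := det_series_twist N_NR sD DN chiM chiD fc fM m_gt0 Dd Dx Hx.
by exists n.+1, f, M'.
Qed.

(** Conjugation by [d] is trivial on the factor at 0. If the contribution of that factor is nonzero,
    [twisted_root] provides what the other factors need. *)
Lemma tau_twist chi d :
  {morph chi : x y / x * y} -> (forall x, D x -> D (chi x)) -> D d ->
  tau D (inner d \o chi) = tau D chi.
Proof.
move=> chiM chiD Dd; set chi' := inner d \o chi.
have chiM' : {morph chi' : x y / x * y}.
  by move=> x y; rewrite /chi' /= chiM innerM.
have chiD' x : D x -> D (chi' x).
  by move=> Dx; apply: inner_in => //; apply: chiD.
have ind0 n (f : G -> 'rV[int]_n) M : factor_coords D (tau_series D 1) f ->
    induced_matrix D chi' f M <-> induced_matrix D chi f M.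
  move=> fc; have eqf x : D x -> f (chi' x) = f (chi x).
    by move=> Dx; apply: abelianisation_twist => //; apply: chiD.
  by split=> fM x Dx; [rewrite -eqf|rewrite eqf]; auto.
have tau0 : factor_absdet D (tau_series D 1) chi' =
            factor_absdet D (tau_series D 1) chi.
  congr xget; apply/seteqP; split=> v [n [f [M [fc fM ->]]]]; exists n, f, M;
    by split=> //; apply/(ind0 n f M fc).
rewrite /tau !big_nat_recl //= tau0.
(* Here both products vanish; this includes the case where 0 is the default of [xget]. *)
have [->|nz] := eqVneq (factor_absdet D (tau_series D 1) chi) 0%N.
  by rewrite !mul0n.
have [n0 [f0 [M0 [fc0 fM0 det0]]]] :
  exists n (f : G -> 'rV[int]_n) (M : 'M[int]_n),
    [/\ factor_coords D (tau_series D 1) f, induced_matrix D chi f M &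
        (\det (1%:M - M) != 0)%R].
  move: nz; rewrite /factor_absdet.
  case: xgetP => [v _ [n [f [M [fc fM ->]]]]|_//].
  by rewrite absz_eq0 => det0; exists n, f, M.
congr (_ * _)%N; apply: eq_bigr => i _; congr xget; apply/seteqP; split=> v.
  have chiE : chi = inner d^-1 \o chi'.
    by apply/funext => x; rewrite /chi' /= innerK.
  rewrite [X in _ -> [set _ | exists n f M,
    [/\ _, induced_matrix _ X _ _ & _]] v]chiE.
  apply: (tau_twist_sub chiM' chiD' (subgroupV sD Dd) fc0 _ det0).
  exact/(ind0 _ _ _ fc0).
exact: (tau_twist_sub chiM chiD Dd fc0 fM0 det0).
Qed.

End TauTwist.
End Twist.

(** * Transport of tau along mutually inverse endomorphisms *)

Section Transport.
Variables (G : groupType) (a b : G -> G).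
Hypotheses (aM : {morph a : x y / x * y}) (bM : {morph b : x y / x * y}).
Hypotheses (aK : cancel a b) (bK : cancel b a).

Lemma lower_central_eq1_transport (S S' : set G) k :
  (forall x, S x -> S' (a x)) -> (forall x, S' x -> S (b x)) ->
  lower_central S k = [set 1] -> lower_central S' k = [set 1].
Proof.
move=> SS' S'S lc1; apply/seteqP; split=> x.
  move=> /(lower_central_morph bM S'S); rewrite lc1 => bx1.
  by rewrite -[x]bK bx1; exact: morph_fun1.
move=> ->; rewrite -(morph_fun1 aM); apply: (lower_central_morph aM SS').
by rewrite lc1.
Qed.

Lemma factor_absdet_transport_sub (A B A' B' : set G) (psi : G -> G) v :
  (forall x, A x -> A' (a x)) -> (forall x, A' x -> A (b x)) ->
  (forall x, B x -> B' (a x)) -> (forall x, B' x -> B (b x)) ->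
  (exists n (f : G -> 'rV[int]_n) M,
    [/\ factor_coords A B f, induced_matrix A psi f M &
        v = `|(\det (1%:M - M))%R|%N]) ->
  exists n (f : G -> 'rV[int]_n) M,
    [/\ factor_coords A' B' f, induced_matrix A' (a \o psi \o b) f M &
        v = `|(\det (1%:M - M))%R|%N].
Proof.
move=> AA' A'A BB' B'B [n [f [M [[fD fsurj fker] fM vE]]]].
exists n, (f \o b), M; split=> //; last first.
  by move=> x /A'A Abx /=; rewrite aK fM.
split=> [x y /A'A Ax /A'A Ay|w|x A'x] /=; first by rewrite bM fD.
  by have [x Ax <-] := fsurj w; exists (a x); [exact: AA' | rewrite aK].
rewrite (fker _ (A'A _ A'x)); split; last exact: B'B.
by move=> /BB'; rewrite bK.
Qed.

End Transport.

(** Composing coordinates with [b] carries them from D to D' with the same matrices. It is applied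
    to [a = inner h], between the groups D_t and D_t' with t' = h t h^-1. *)
Lemma tau_transport (G : groupType) (a b psi : G -> G) (D D' : set G) :
  {morph a : x y / x * y} -> {morph b : x y / x * y} ->
  cancel a b -> cancel b a ->
  (forall x, D x -> D' (a x)) -> (forall x, D' x -> D (b x)) ->
  tau D' (a \o psi \o b) = tau D psi.
Proof.
move=> aM bM aK bK DD' D'D.
have HH' := isolated_derived_morph aM DD'.
have H'H := isolated_derived_morph bM D'D.
have psiE : psi = b \o (a \o psi \o b) \o a.
  by apply/funext => x /=; rewrite !aK.
have lcE k : lower_central (isolated_derived D') k = [set 1] <->
             lower_central (isolated_derived D) k = [set 1].
  split; first exact: (lower_central_eq1_transport bM aM aK H'H HH').
  exact: (lower_central_eq1_transport aM bM bK HH' H'H).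
have classE : nilpotency_class (isolated_derived D') =
              nilpotency_class (isolated_derived D).
  congr xget; apply/seteqP.
  by split=> c [/lcE c1 cmin]; split=> // m /lcE; apply: cmin.
rewrite /tau classE.
apply: eq_bigr => i _; congr xget.
have ss i := tau_series_morph (i := i) aM DD'.
have ss' i := tau_series_morph (i := i) bM D'D.
apply/seteqP; split=> v.
  rewrite {2}psiE.
  exact: (factor_absdet_transport_sub aM bK aK
            (ss' i) (ss i) (ss' i.+1) (ss i.+1)).
exact: (factor_absdet_transport_sub bM aK bK
          (ss i) (ss' i) (ss i.+1) (ss' i.+1)).
Qed.

(** * The summands of the averaged invariant *)

Section Summands.
Variables (G : groupType) (phi : UMagmaMorphism.type G G) (N : set G).
Hypotheses (N_NR : NR_group N) (N_normal : normal_in [set: G] N).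
Hypothesis phi_N : forall x : G, N x -> N (phi x).
Implicit Types (t g c h x y : G).

Let phiM : {morph phi : x y / x * y}. Proof. exact: gmulfM. Qed.

Let sN : subgroup N. Proof. by case: N_normal. Qed.

Let innerN g x : N x -> N (inner g x).
Proof. by case: N_normal => _ _; apply. Qed.

Lemma subgroup_centraliser t : subgroup (centraliser t).
Proof.
split=> [|x y xt yt]; first by rewrite /centraliser /= /commute mul1g mulg1.
apply/commute_inner; rewrite innerMl -{1}((commute_inner y t).1 yt) innerK.
exact/commute_inner.
Qed.

Lemma centraliser_inner t h x :
  centraliser t x -> centraliser (inner h t) (inner h x).
Proof. by rewrite /centraliser /= /commute -!innerM => ->. Qed.

Lemma subgroup_centraliser_in t : subgroup (centraliser_in N t).
Proof.
have sC := subgroup_centraliser t.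
split=> [|x y [Nx Cx] [Ny Cy]]; first by split; exact: subgroup1.
by split; [apply: (proj2 sN) | apply: (proj2 sC)].
Qed.

Lemma centraliser_in_inner t h x :
  centraliser_in N t x -> centraliser_in N (inner h t) (inner h x).
Proof.
by move=> [Nx Cx]; split; [exact: innerN | exact: centraliser_inner].
Qed.

Lemma centraliser_in_normal t c x : centraliser t c ->
  centraliser_in N t x -> centraliser_in N t (inner c x).
Proof.
by move=> /commute_inner tc; rewrite -{2}tc; apply: centraliser_in_inner.
Qed.

Lemma centraliser_in_twist t g x : t = inner g (phi t) ->
  centraliser_in N t x -> centraliser_in N t (inner g (phi x)).
Proof.
move=> tg [Nx Cx]; rewrite {1}tg; apply: centraliser_in_inner.
by split; [exact: phi_N | rewrite /centraliser /= /commute -!phiM Cx].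
Qed.

(** If c' = c d, then iota_c' = iota_e iota_c with e = c d c^-1 in D_t, so this is [tau_twist]. *)
Lemma tau_lcoset t g c c' : t = inner g (phi t) ->
  centraliser t c -> centraliser t c' ->
  lcoset (centraliser_in N t) c = lcoset (centraliser_in N t) c' ->
  tau (centraliser_in N t) (inner c \o (inner g \o phi)) =
  tau (centraliser_in N t) (inner c' \o (inner g \o phi)).
Proof.
move=> tg Cc Cc' cc'; have sD := subgroup_centraliser_in t.
have [d Dd cd] : lcoset (centraliser_in N t) c c'.
  by rewrite cc'; exists 1; [exact: subgroup1 | rewrite mulg1].
have -> : inner c' \o (inner g \o phi) =
          inner (inner c d) \o (inner c \o (inner g \o phi)).
  by apply/funext => x /=; rewrite -!innerMl -cd {2}/inner mulgVK.
apply/esym/(@tau_twist _ N) => //.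
- by move=> x [].
- by move=> x y /=; rewrite phiM (innerM g) (innerM c).
- move=> x Dx /=; apply: centraliser_in_normal => //.
  exact: centraliser_in_twist.
- exact: centraliser_in_normal.
Qed.

Lemma mem_lcosets t X x y :
  lcosets (centraliser t) (centraliser_in N t) X -> X x -> X y ->
  [/\ centraliser t x, X = lcoset (centraliser_in N t) x &
      lcoset (centraliser_in N t) x = lcoset (centraliser_in N t) y].
Proof.
have sC := subgroup_centraliser t; have sD := subgroup_centraliser_in t.
have cosetE c d : centraliser_in N t d ->
    lcoset (centraliser_in N t) (c * d) = lcoset (centraliser_in N t) c.
  move=> Dd; apply/seteqP; split=> _ [d' Dd' <-].
    by exists (d * d'); [exact: (subgroupM sD) | rewrite mulgA].
  exists (d^-1 * d'); last by rewrite mulgA mulgK.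
  by apply: (subgroupM sD) => //; apply: (subgroupV sD).
move=> [c Cc <-] [d Dd <-] [d' Dd' <-]; rewrite !cosetE //; split=> //.
by apply: (subgroupM sC) => //; case: Dd.
Qed.

Lemma lcosets_lcoset t x : centraliser t x ->
  lcosets (centraliser t) (centraliser_in N t) (lcoset (centraliser_in N t) x).
Proof. by exists x. Qed.

(** For t' = h t h^-1 and [u] in C_t', it sends c D_t' to (h^-1 c u h) D_t, because [u] normalises
    D_t'. *)
Definition coset_transport h u (X : set G) : set G :=
  [set inner h^-1 (x * u) | x in X].

Lemma coset_transport_lcoset t h u c : centraliser (inner h t) u ->
  coset_transport h u (lcoset (centraliser_in N (inner h t)) c) =
  lcoset (centraliser_in N t) (inner h^-1 (c * u)).
Proof.
move=> Cu; have sC := subgroup_centraliser (inner h t).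
apply/seteqP; split=> [_ [_ [d Dd <-] <-]|_ [d Dd <-]].
  exists (inner h^-1 (inner u^-1 d)).
    rewrite -{1}[t](innerK h); apply: centraliser_in_inner.
    by apply: centraliser_in_normal => //; apply: (subgroupV sC).
  by rewrite -innerM /inner invgK !mulgA mulgK.
exists (c * inner u (inner h d)).
  exists (inner u (inner h d)) => //; apply: centraliser_in_normal => //.
  exact: centraliser_in_inner.
by rewrite /inner !invgK !mulgA !mulgVK.
Qed.

Lemma coset_transport_bij t h u : centraliser (inner h t) u ->
  set_bij (lcosets (centraliser (inner h t)) (centraliser_in N (inner h t)))
    (lcosets (centraliser t) (centraliser_in N t)) (coset_transport h u).
Proof.
move=> Cu; have sC := subgroup_centraliser (inner h t).
split.
- move=> _ [c Cc <-]; rewrite coset_transport_lcoset //; apply: lcosets_lcoset.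
  rewrite -{1}[t](innerK h); apply: centraliser_inner.
  exact: (subgroupM sC).
- have inj : injective (fun x => inner h^-1 (x * u)).
    by move=> x y /(can_inj (innerKV h)); apply: mulIg.
  move=> X Y _ _ XY; apply/funext => x.
  rewrite -(image_inj (A := X) inj) -(image_inj (A := Y) inj).
  by rewrite -/(coset_transport h u X) XY.
- move=> _ [c Cc <-].
  exists (lcoset (centraliser_in N (inner h t)) (inner h c * u^-1)).
    apply: lcosets_lcoset; apply: (subgroupM sC); last exact: (subgroupV sC).
    exact: centraliser_inner.
  by rewrite coset_transport_lcoset // mulgVK innerK.
Qed.

Lemma Rtilde_summand_transport t h g g' r r' :
  t = inner g (phi t) -> inner h t = inner g' (phi (inner h t)) ->
  coset_reps (centraliser t) (centraliser_in N t) r ->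
  coset_reps (centraliser (inner h t)) (centraliser_in N (inner h t)) r' ->
  Rtilde_summand phi N t g r = Rtilde_summand phi N (inner h t) g' r'.
Proof.
move=> tg tg' rP rP'; set t' := inner h t in tg' rP' *.
(* The element h g phi(h)^-1 is the choice for t' transported from [g]; it differs from the given
   choice [g'] by the factor [u], which centralises t'. *)
pose u := g' * (h * g / phi h)^-1.
have g'E : g' = u * (h * g / phi h) by rewrite /u mulgVK.
have Cu : centraliser t' u.
  apply/commute_inner; rewrite {1}/t' {1}tg -!innerMl.
  rewrite [RHS]tg' /t' (inner_morph _ _ phiM) -innerMl; congr (inner _ _).
  by rewrite g'E !mulgA mulgVK.
have bij := coset_transport_bij Cu.
congr (_^-1 * _)%R.
  congr (_%:R)%R; rewrite /group_index.
  have cardE : (lcosets (centraliser t) (centraliser_in N t) #=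
                lcosets (centraliser t') (centraliser_in N t'))%card.
    by rewrite card_eq_sym; apply/card_set_bijP; exists (coset_transport h u).
  (* For infinite sets of cosets both indices come from the same default of [fset_set]. *)
  have [[n Cn]|infC] :=
    pselect (finite_set (lcosets (centraliser t) (centraliser_in N t))).
    rewrite (card_fset_set Cn) (card_fset_set (n := n)) //.
    by apply: card_eq_trans Cn; rewrite card_eq_sym.
  rewrite /fset_set; case: pselect => // _; case: pselect => // finC'.
  by case: infC; rewrite (eq_finite_set cardE).
rewrite (reindex_fsbig _ _ _ _ bij); apply: eq_fsbigr => X /set_mem CX.
have [bijf _ _] := bij; have CkX := bijf X CX.
have kX : coset_transport h u X (inner h^-1 (r' X * u)).
  by exists (r' X) => //; apply: rP'.
(* The transported representative and the one chosen by [r] lie in the same coset, so [tau_lcoset]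
   exchanges them. *)
have [Ct _ eqc] := mem_lcosets CkX kX (rP _ CkX).
have [Ctr _ _] := mem_lcosets CkX (rP _ CkX) kX.
rewrite -(tau_lcoset tg Ct Ctr eqc); congr (_%:R)%R.
rewrite -(@tau_transport _ (inner h) (inner h^-1) _ (centraliser_in N t)
  (centraliser_in N t')).
- congr tau; apply/funext => x /=; rewrite (inner_morph _ _ phiM) -!innerMl.
  congr (inner _ _); rewrite g'E /inner invgK (morph_funV phiM) !mulgA.
  by rewrite mulgV mul1g.
- exact: innerM.
- exact: innerM.
- exact: innerK.
- exact: innerKV.
- by move=> x; apply: centraliser_in_inner.
- by move=> x; rewrite -{1}[t](innerK h); apply: centraliser_in_inner.
Qed.

(** From t = x phi(s) x^-1 and s = y t y^-1 one obtains g = x phi(y). *)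
Lemma fixed_class_choices (K : set G) : fixed_classes phi K ->
  exists t g, K t /\ t = inner g (phi t).
Proof.
move=> [[t _ Kt] KK]; have Kt' : K t by rewrite -Kt; exists 1; rewrite ?inner1.
have [s Ks [x _ tx]] : class_map phi K t by rewrite KK.
move: Ks; rewrite -Kt => -[y _ sy].
exists t, (x * phi y); split; first by rewrite Kt.
by rewrite innerMl -(inner_morph _ _ phiM) sy tx.
Qed.

(** Two members of a class are conjugate, so the transport lemma applies; for [t' = t] this is
    independence of g_t. *)
Lemma Rtilde_summand_choice K t t' g g' r r' : fixed_classes phi K ->
  K t -> K t' -> t = inner g (phi t) -> t' = inner g' (phi t') ->
  coset_reps (centraliser t) (centraliser_in N t) r ->
  coset_reps (centraliser t') (centraliser_in N t') r' ->
  Rtilde_summand phi N t g r = Rtilde_summand phi N t' g' r'.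
Proof.
move=> [[s _ <-] _] [x _ xs] [y _ ys].
have -> : t' = inner (y * x^-1) t by rewrite innerMl -xs innerK.
exact: Rtilde_summand_transport.
Qed.

Lemma coset_reps_exist t :
  exists r, coset_reps (centraliser t) (centraliser_in N t) r.
Proof.
have /choice[r rP] X : exists x,
    lcosets (centraliser t) (centraliser_in N t) X -> X x.
  have [[c _ <-]|nX] :=
    pselect (lcosets (centraliser t) (centraliser_in N t) X).
    exists c => _; exists 1; last by rewrite mulg1.
    exact: subgroup1 (subgroup_centraliser_in t).
  by exists 1.
by exists r.
Qed.

Lemma Rtilde_choices_exist :
  exists (t g : set G -> G) (r : set G -> set G -> G),
    Rtilde_choices phi N t g r.
Proof.
have /choice[tgr tgrP] K : exists tgr : G * G * (set G -> G),
    fixed_classes phi K ->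
    [/\ K tgr.1.1, tgr.1.1 = inner tgr.1.2 (phi tgr.1.1) &
      coset_reps (centraliser tgr.1.1) (centraliser_in N tgr.1.1) tgr.2].
  have [fK|nfK] := pselect (fixed_classes phi K).
    have [t [g [Kt tg]]] := fixed_class_choices fK.
    by have [r rP] := coset_reps_exist t; exists (t, g, r).
  (* Arbitrary values outside the fixed classes, where nothing is required. *)
  by exists (1, 1, fun=> 1).
by exists (fun K => (tgr K).1.1), (fun K => (tgr K).1.2), (fun K => (tgr K).2).
Qed.

Lemma Rtilde_unique (t g t' g' : set G -> G) (r r' : set G -> set G -> G) :
  Rtilde_choices phi N t g r -> Rtilde_choices phi N t' g' r' ->
  Rtilde phi N t g r = Rtilde phi N t' g' r'.
Proof.
move=> tgr tgr'; apply: eq_fsbigr => K /set_mem fK.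
have [Kt tg rP] := tgr K fK; have [Kt' tg' rP'] := tgr' K fK.
exact: (Rtilde_summand_choice fK).
Qed.

End Summands.

Theorem proposition4p2 (G : groupType) (phi : UMagmaMorphism.type G G)
    (N : set G)
    (G_vpc : virtually_polycyclic [set: G]%classic)
    (N_NR : NR_group N)
    (N_normal : normal_in [set: G]%classic N)
    (N_index : finite_index [set: G]%classic N)
    (phi_N : forall x : G, N x -> N (phi x)) :
  [/\ exists! v : rat,
        exists (t g : set G -> G) (r : set G -> set G -> G),
          Rtilde_choices phi N t g r /\ v = Rtilde phi N t g r,
      forall K : set G, fixed_classes phi K ->
        forall t g : G, K t -> t = inner g (phi t) ->
        forall c c' : G, centraliser t c -> centraliser t c' ->
          lcoset (centraliser_in N t) c = lcoset (centraliser_in N t) c' ->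
          tau (centraliser_in N t) (inner c \o (inner g \o phi)) =
          tau (centraliser_in N t) (inner c' \o (inner g \o phi)),
      forall K : set G, fixed_classes phi K ->
        forall t g g' : G, K t ->
          t = inner g (phi t) -> t = inner g' (phi t) ->
        forall r r' : set G -> G,
          coset_reps (centraliser t) (centraliser_in N t) r ->
          coset_reps (centraliser t) (centraliser_in N t) r' ->
          Rtilde_summand phi N t g r = Rtilde_summand phi N t g' r' &
      forall K : set G, fixed_classes phi K ->
        forall t t' g g' : G, K t -> K t' ->
          t = inner g (phi t) -> t' = inner g' (phi t') ->
        forall r r' : set G -> G,
          coset_reps (centraliser t) (centraliser_in N t) r ->
          coset_reps (centraliser t') (centraliser_in N t') r' ->
          Rtilde_summand phi N t g r = Rtilde_summand phi N t' g' r'].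
Proof.
have [t0 [g0 [r0 tgr]]] := Rtilde_choices_exist phi N_normal.
split.
- exists (Rtilde phi N t0 g0 r0); split; first by exists t0, g0, r0.
  by move=> _ [t' [g' [r' [tgr' ->]]]]; apply: Rtilde_unique.
- by move=> K _ t g _ tg c c'; apply: tau_lcoset.
- move=> K fK t g g' Kt tg tg' r r' rP rP'.
  exact: (Rtilde_summand_choice N_NR N_normal phi_N fK).
- move=> K fK t t' g g' Kt Kt' tg tg' r r' rP rP'.
  exact: (Rtilde_summand_choice N_NR N_normal phi_N fK).
Qed.
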